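(* Let $n\ge2$ and let $A$ be the $n\times n$ Hermitian matrix $$A=\begin{pmatrix}d_1&&&&a_1\\&d_2&&&a_2\\&&\ddots&&\vdots\\&&&d_{n-1}&a_{n-1}\\\bar a_1&\bar a_2&\cdots&\bar a_{n-1}&\mathbf a\end{pmatrix}$$ (all unmarked entries zero) with $d_1,\dots,d_{n-1}\in\mathbb R$ and $a_1,\dots,a_{n-1}\in\mathbb C$ fixed, and with $\mathbf a\in\mathbb R$ variable. Denote the eigenvalues of $A$ by $\lambda=(\lambda_1,\dots,\lambda_n)$. Let $\epsilon>0$ be a fixed constant. Suppose that $\mathbf a$ satisfies $$\mathbf a\ge\frac{2n-3}{\epsilon}\sum_{i=1}^{n-1}|a_i|^2+(n-1)\sum_{i=1}^{n-1}|d_i|+\frac{(n-2)\epsilon}{2n-3}.$$ Then, possibly after a proper permutation of the eigenvalues, $$d_\alpha-\epsilon<\lambda_\alpha<d_\alpha+\epsilon\quad\text{for all }1\le\alpha\le n-1,\qquad \mathbf a\le\lambda_n<\mathbf a+(n-1)\epsilon.$$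
   Context: Eigenvalues are listed with algebraic multiplicity. *)

(* Defs.v *)
From mathcomp Require Import all_boot all_order all_algebra.
From mathcomp Require Import reals.
From mathcomp Require Export complex.

Set Implicit Arguments.
Unset Strict Implicit.
Unset Printing Implicit Defensive.

Import GRing.Theory Num.Theory.
Local Open Scope ring_scope.
Local Open Scope complex_scope.

(* The bordered diagonal matrix; for n >= 2 its size n.-1 + 1 equals n.  The
   indices 0, ..., n-2 are lshift 1 i, the last index is rshift n.-1 ord0.   *)
Definition arrow_mx (R : realType) (n : nat)
    (d : 'I_n.-1 -> R) (a : 'I_n.-1 -> R[i]) (b : R) : 'M[R[i]]_(n.-1 + 1) :=
  block_mx (diag_mx (\row_i (d i)%:C)) (\col_i a i)
           (\row_i (a i)^*)            (b%:C)%:M.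

(* Listing with algebraic multiplicity: the multiset of values of lambda is
   the multiset of roots of the characteristic polynomial.                   *)
Definition eigenvalues_of (R : realType) (m : nat)
    (A : 'M[R[i]]_m) (lambda : 'I_m -> R[i]) : Prop :=
  char_poly A = \prod_i ('X - (lambda i)%:P).

(* R[i] carries the partial order of a numClosedFieldType: x <= y (x < y)
   means that Im x = Im y and Re x <= Re y (Re x < Re y).  An inequality
   between lambda i and x%:C thus also says that lambda i is real.           *)

(* Main.v *)
(** With c_i = |a_i|^2, the characteristic polynomial is prod_i (t - d_i) times
    the secular function f(t) = t - b - sum_i c_i / (t - d_i).  Let d_1 be the
    smallest of the d_i.  If d_1 is repeated, t - d_1 splits off and the two
    weights merge.  Otherwise f changes sign on (d_1 - eps, d_1], which gives a
    root mu there, and f(t) (t - d_1) / (t - mu) is the secular function of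
    d_2, ..., d_(n-1) with smaller nonnegative weights c_j (d_j - d_1) / (d_j - mu)
    and the larger corner b + d_1 - mu.  So the condition
    sum c_i <= eps (b - d_j) for all j is inherited and the argument iterates.
    The root left at the end is b + sum_i (d_i - mu_i), with 0 <= d_i - mu_i < eps. *)
Require Import Defs.
From mathcomp Require Import all_boot all_order all_algebra all_fingroup.
From mathcomp Require Import reals complex ring lra.

Import Order.TTheory GRing.Theory Num.Theory.
Local Open Scope ring_scope.
Local Open Scope complex_scope.

(** * Algebra of the secular polynomial *)

(** The secular function with its denominators cleared. Indexing by a sequence lets the induction
    drop one index at a time. *)
Definition arrow_poly {F : fieldType} {T : eqType}
    (d c : T -> F) (b : F) (s : seq T) : {poly F} :=
  ('X - b%:P) * \prod_(i <- s) ('X - (d i)%:P)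
  - \sum_(i <- s) (c i)%:P * \prod_(j <- s | j != i) ('X - (d j)%:P).

Section ArrowPoly.

Context {F : fieldType} {T : eqType}.
Implicit Types (d c : T -> F) (b : F) (s : seq T).

Lemma eq_arrow_poly d c c' b s :
  {in s, c =1 c'} -> arrow_poly d c b s = arrow_poly d c' b s.
Proof.
move=> cc'; congr (_ - _); apply: eq_big_seq => i si.
by rewrite cc'.
Qed.

Lemma arrow_poly_cons d c b x s : x \notin s ->
  arrow_poly d c b (x :: s) =
  ('X - (d x)%:P) * arrow_poly d c b s
  - (c x)%:P * \prod_(i <- s) ('X - (d i)%:P).
Proof.
move=> xs; rewrite /arrow_poly !big_cons eqxx /=.
have -> : \prod_(j <- s | j != x) ('X - (d j)%:P) = \prod_(j <- s) ('X - (d j)%:P).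
  rewrite big_seq_cond [RHS]big_seq; apply: eq_bigl => i.
  by rewrite andb_idr // => si; apply: contraNneq xs => <-.
have -> : \sum_(i <- s) (c i)%:P * \prod_(j <- x :: s | j != i) ('X - (d j)%:P) =
    ('X - (d x)%:P) *
    \sum_(i <- s) (c i)%:P * \prod_(j <- s | j != i) ('X - (d j)%:P).
  rewrite big_distrr; apply: eq_big_seq => i si.
  rewrite big_cons; case: eqP => [xi|_] /=; last by rewrite mulrCA.
  by move: xs; rewrite xi si.
by ring.
Qed.

Lemma arrow_poly_merge d c b x y s :
    uniq [:: x, y & s] -> d x = d y ->
  arrow_poly d c b [:: x, y & s] =
  ('X - (d x)%:P) *
  arrow_poly d (fun i => if i == y then c x + c y else c i) b (y :: s).
Proof.
move=> /= /and3P[xys ys _] dxy.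
rewrite !arrow_poly_cons // big_cons -dxy eqxx.
rewrite (eq_arrow_poly d (fun i => if i == y then c x + c y else c i) c).
  by rewrite polyCD; ring.
move=> i si; case: eqP => // iy; by move: ys; rewrite -iy si.
Qed.

Lemma horner_arrow_poly d c b s t : uniq s -> {in s, forall i, t != d i} ->
  (arrow_poly d c b s).[t] =
  (\prod_(i <- s) ('X - (d i)%:P)).[t]
  * (t - b - \sum_(i <- s) c i / (t - d i)).
Proof.
move=> us tNd; rewrite /arrow_poly mulrBr !(hornerE, horner_sum); congr (_ - _).
  by rewrite mulrC.
rewrite big_distrr /=; apply: eq_big_seq => i si.
rewrite (bigD1_seq i) //= !hornerE /=; field.
by rewrite subr_eq0 tNd.
Qed.

(* Dividing the secular function f by (t - mu) / (t - d x) for a zero mu of f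
   gives a secular function again, with the weights rescaled. *)
Lemma arrow_poly_deflate d c b x s mu :
    uniq (x :: s) -> {in s, forall i, mu != d i} ->
    root (arrow_poly d c b (x :: s)) mu ->
  arrow_poly d c b (x :: s) =
  ('X - mu%:P) * arrow_poly d (fun i => c i * ((d i - d x) / (d i - mu)))
                   (b + (d x - mu)) s.
Proof.
move=> /= /andP[xs us] muNd; set c' := fun i => _; set b' := b + _.
set Q := \prod_(i <- s) ('X - (d i)%:P).
pose S c := \sum_(i <- s) (c i)%:P * \prod_(j <- s | j != i) ('X - (d j)%:P).
(* By the choice of [c'], the two [i]-th summands agree at [d i]; their difference thus regains the
   missing factor of [Q]. *)
have SE : ('X - (d x)%:P) * S c - ('X - mu%:P) * S c' =
          (\sum_(i <- s) (c i - c' i))%:P * Q.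
  rewrite !big_distrr -sumrB rmorph_sum big_distrl /=; apply: eq_big_seq => i si.
  rewrite /Q (bigD1_seq i) //=.
  have ci : c i * (d i - d x) = c' i * (d i - mu).
    by rewrite /c'; field; rewrite subr_eq0 eq_sym muNd.
  have {}ci : (c i)%:P * ((d i)%:P - (d x)%:P) =
              (c' i)%:P * ((d i)%:P - mu%:P) :> {poly F}.
    by rewrite -!polyCB -!polyCM ci.
  rewrite polyCB.
  set q := \prod_(_ <- _ | _) _.
  have -> : ('X - (d x)%:P) * ((c i)%:P * q) =
     (c i)%:P * ('X - (d i)%:P) * q + (c i)%:P * ((d i)%:P - (d x)%:P) * q.
    by ring.
  by rewrite ci; ring.
(* The corner [b'] cancels the terms in ['X * Q], so both sides differ by a constant [k] times [Q].
   Evaluation at [mu], where [Q] does not vanish, forces [k = 0]. *)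
pose k := b * d x - mu * b' - c x - \sum_(i <- s) (c i - c' i).
have kE : arrow_poly d c b (x :: s) =
    ('X - mu%:P) * arrow_poly d c' b' s + k%:P * Q.
  rewrite [k%:P]polyCB [(_ - _) * Q]mulrBl -SE arrow_poly_cons // /arrow_poly.
  by rewrite -/Q -/(S c) -/(S c') /b' !(polyCB, polyCD, polyCM); ring.
rewrite kE rootE !hornerE subrr mul0r add0r mulf_eq0.
have /negPf-> : Q.[mu] != 0.
  rewrite /Q horner_prod prodf_seq_neq0; apply/allP => i si /=.
  by rewrite !hornerE subr_eq0 muNd.
by rewrite orbF => /eqP->; rewrite mul0r addr0.
Qed.

End ArrowPoly.

(** * Real roots by the intermediate value theorem *)

Lemma root_arrow_poly (R : rcfType) (T : eqType) (d c : T -> R) (b eps : R)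
    (x : T) (s : seq T) :
    0 < eps -> uniq (x :: s) -> {in x :: s, forall i, 0 <= c i} ->
    {in s, forall i, d x < d i} ->
    \sum_(i <- x :: s) c i <= eps * (b - d x) ->
  exists2 mu, d x - eps < mu <= d x & root (arrow_poly d c b (x :: s)) mu.
Proof.
move=> e0 /= /andP[xs us] c0 dxd; rewrite big_cons => cb.
set Q := \prod_(i <- s) ('X - (d i)%:P).
have Q0 t : t <= d x -> Q.[t] != 0.
  move=> tx; rewrite /Q horner_prod prodf_seq_neq0; apply/allP => i si /=.
  by rewrite !hornerE subr_eq0 lt_eqF // (le_lt_trans tx) ?dxd.
(* The secular function times [t - d x], which removes the pole at [d x]. *)
pose g t := (t - d x) * (t - b) - c x - (t - d x) * \sum_(i <- s) c i / (t - d i).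
(* The extra factor [Q] turns the sign of [Q], which depends on the parity of [size s], into a
   square. The minus sign suits [poly_ivt], which wants a rise from left to right. *)
have PE t : t <= d x -> (- (arrow_poly d c b (x :: s) * Q)).[t] = - (Q.[t] ^+ 2 * g t).
  move=> tx; rewrite arrow_poly_cons // -/Q.
  have : (arrow_poly d c b s).[t] =
         Q.[t] * (t - b - \sum_(i <- s) c i / (t - d i)).
    apply: horner_arrow_poly => // i si.
    by rewrite lt_eqF // (le_lt_trans tx) ?dxd.
  by move: (arrow_poly d c b s) => p pE; rewrite !hornerE pE /g; ring.
have ex : d x - eps <= d x by lra.
(* Here each [d i] with [i] in [s] lies more than [eps] to the right, so the weights cost at most
   their total, which is at most [eps * (b - d x)]; a margin [eps * eps] remains. *)
have ge : 0 < g (d x - eps).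
  have: \sum_(i <- s) - (c i / (d x - eps - d i)) <= \sum_(i <- s) c i / eps.
    rewrite big_seq [leRHS]big_seq; apply: ler_sum => i si.
    rewrite -mulrN -invrN ler_wpM2l ?c0 ?inE ?si ?orbT //.
    by have := dxd _ si; move=> h; rewrite lef_pV2 ?posrE //; lra.
  rewrite sumrN -mulr_suml ler_pdivlMr // => h.
  have e2 : 0 < eps * eps by rewrite mulr_gt0.
  rewrite /g; nra.
have gd : g (d x) <= 0 by rewrite /g !subrr !mul0r sub0r subr0 oppr_le0 c0 ?inE ?eqxx.
have [|mu /andP[exmu mux]] :=
    @poly_ivt R (- (arrow_poly d c b (x :: s) * Q)) _ _ ex.
  rewrite !PE // oppr_le0 oppr_ge0 mulr_ge0 ?sqr_ge0 ?(ltW ge) //=.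
  by rewrite mulr_ge0_le0 ?sqr_ge0.
rewrite rootN rootM [root Q mu]rootE (negPf (Q0 _ mux)) orbF => rmu.
exists mu => //; rewrite mux andbT lt_neqAle exmu andbT.
(* The left endpoint is excluded because [g] is strictly positive there. *)
apply: contraTneq rmu => <-; rewrite -(orbF (root _ _)) -(negPf (Q0 _ ex)) -rootE.
rewrite -rootM -rootN rootE PE // oppr_eq0 mulf_neq0 ?gt_eqF //.
by rewrite exprn_even_gt0 //= Q0.
Qed.

Lemma arrow_poly_split (R : rcfType) (T : eqType) (d c : T -> R) (b eps : R)
    (s : seq T) :
    0 < eps -> uniq s -> sorted (relpre d <=%R) s ->
    {in s, forall i, 0 <= c i} ->
    {in s, forall i, \sum_(j <- s) c j <= eps * (b - d i)} ->
  exists2 mu : T -> R, {in s, forall i, d i - eps < mu i <= d i} &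
    arrow_poly d c b s = ('X - (b + \sum_(i <- s) (d i - mu i))%:P) *
                         \prod_(i <- s) ('X - (mu i)%:P).
Proof.
move=> e0; elim: s c b => [|x s IHs] c b.
  by exists d => //; rewrite /arrow_poly !big_nil subr0 addr0.
move=> us ds c0 cb.
(* Common to both cases: splitting off a root [m] raises the corner and does not raise the total
   weight, so the weight condition passes to [s]. *)
have IH c' b' m : d x - eps < m <= d x -> b' = b + (d x - m) ->
    {in s, forall i, 0 <= c' i} ->
    \sum_(i <- s) c' i <= \sum_(i <- x :: s) c i ->
    arrow_poly d c b (x :: s) = ('X - m%:P) * arrow_poly d c' b' s ->
  exists2 mu : T -> R, {in x :: s, forall i, d i - eps < mu i <= d i} &
    arrow_poly d c b (x :: s) =
    ('X - (b + \sum_(i <- x :: s) (d i - mu i))%:P) *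
    \prod_(i <- x :: s) ('X - (mu i)%:P).
  move=> mx b'E c'0 c'c ->; move: us => /= /andP[xs us].
  have [|i si|mu muP ->] := IHs c' b' us _ c'0.
  - exact: path_sorted ds.
  - apply: (le_trans c'c); apply: (le_trans (cb i _)); rewrite ?inE ?si ?orbT //.
    by rewrite ler_pM2l // b'E; case/andP: mx => _; lra.
  have muE : {in s, (fun i => if i == x then m else mu i) =1 mu}.
    by move=> i si; case: eqP => // ix; move: xs; rewrite -ix si.
  exists (fun i => if i == x then m else mu i) => [i|].
    by rewrite inE; case: eqP => [->//|_] /= /muP.
  rewrite !big_cons eqxx b'E -addrA mulrCA; congr (('X - _%:P) * (_ * _)).
    by congr (_ + (_ + _)); apply: eq_big_seq => i /muE->.
  by apply: eq_big_seq => i /muE->.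
have [dxs|] := boolP (all (fun i => d x < d i) s).
  have {}dxs : {in s, forall i, d x < d i} by exact/allP.
  have [mu mux rmu] := root_arrow_poly R T d c b eps x s e0 us c0 dxs (cb x (mem_head _ _)).
  have dmu : {in s, forall i, mu < d i}.
    by move=> i /dxs; case/andP: mux => _; apply: le_lt_trans.
  have cx : 0 <= c x by rewrite c0 // mem_head.
  have {}c0 : {in s, forall i, 0 <= c i}.
    by move=> i si; rewrite c0 // inE si orbT.
  apply: (IH _ _ mu mux erefl _ _ (arrow_poly_deflate d c b x s mu us _ rmu)).
  - by move=> i si; rewrite mulr_ge0 ?c0 // divr_ge0 // subr_ge0 ltW ?dxs ?dmu.
  - rewrite big_cons -[leLHS]add0r lerD //.
    rewrite [leLHS]big_seq [leRHS]big_seq; apply: ler_sum => i si.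
    rewrite ler_piMr ?c0 // ler_pdivrMr ?subr_gt0 ?dmu // mul1r.
    by rewrite lerB //; case/andP: mux.
  by move=> i /dmu; rewrite neq_lt => ->.
(* Some entry does not exceed [d x]; by sortedness the next one, [d y], then equals [d x]. *)
case: s us ds c0 cb IH {IHs} => [//|y s] us ds c0 cb IH.
have [dxy _|dxy] := eqVneq (d x) (d y).
  apply: (IH _ b (d x) _ _ _ _ (arrow_poly_merge _ _ _ _ _ _ us dxy)).
  - by rewrite lexx andbT; lra.
  - by rewrite subrr addr0.
  - move=> i si; case: eqP => _; rewrite ?addr_ge0 ?c0 ?inE ?eqxx ?orbT //.
    by move: si; rewrite inE => ->; rewrite orbT.
  rewrite !big_cons eqxx addrA lerD2l le_eqVlt; apply/orP; left; apply/eqP.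
  apply: eq_big_seq => i si; case: eqP => // iy.
  by move: us; rewrite -iy /= si andbF.
case/negP; move: ds => /= /andP[lexy ds].
have ltxy : d x < d y by rewrite lt_neqAle dxy.
rewrite ltxy /=; apply/allP => i si; apply: (lt_le_trans ltxy).
have dtr : transitive (relpre d <=%R) by move=> ? ? ?; apply: le_trans.
by have /allP/(_ _ si) := order_path_min dtr ds.
Qed.

(** Division-free elimination: right multiplication by the block triangular [B], of determinant [D],
    clears the border column, and the nonzero [D] is then cancelled. *)
Lemma det_arrow (F : idomainType) (m : nat) (u v w : 'I_m -> F) (z : F) :
    (forall i, u i != 0) ->
  \det (block_mx (diag_mx (\row_i u i)) (\col_i v i) (\row_i w i) z%:M
         : 'M_(m + 1)) =
  z * \prod_i u i - \sum_i w i * v i * \prod_(j | j != i) u j.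
Proof.
move=> u0; set A := block_mx _ _ _ _; set D := \prod_i u i.
have D0 : D != 0 by apply/prodf_neq0.
pose E := \col_i (- v i * \prod_(j | j != i) u j).
pose B : 'M_(m + 1) := block_mx 1%:M E 0 D%:M.
have AB : A *m B = block_mx (diag_mx (\row_i u i)) 0 (\row_i w i)
    (z * D - \sum_i w i * v i * \prod_(j | j != i) u j)%:M.
  rewrite mulmx_block !mulmx1 !mulmx0 !addr0; congr block_mx.
    apply/colP => i; rewrite mul_diag_mx !mxE big_ord1 !mxE eqxx mulr1n.
    by rewrite [D](bigD1 i) //=; ring.
  apply/rowP => i; rewrite !ord1 !mxE big_ord1 !mxE eqxx !mulr1n addrC.
  rewrite -sumrN; congr (_ + _); apply: eq_bigr => j _.
  by rewrite !mxE; ring.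
apply: (mulIf D0); have := congr1 determinant AB.
rewrite det_mulmx det_ublock det_lblock det1 mul1r !det_scalar1 det_diag => ->.
by rewrite mulrC; congr (_ * _); apply: eq_bigr => i _; rewrite mxE.
Qed.

(** Only the products of [a i] with its conjugate enter, so the polynomial is real and the real root
    analysis applies. *)
Lemma char_poly_arrow_mx (R : realType) (n : nat) (d : 'I_n.-1 -> R)
    (a : 'I_n.-1 -> R[i]) (b : R) :
  char_poly (arrow_mx d a b) =
  map_poly (real_complex R)
    (arrow_poly d (fun i => ComplexField.Normc.normc (a i) ^+ 2) b
       (index_enum 'I_n.-1)).
Proof.
rewrite /char_poly; set M := char_poly_mx _.
have -> : M = block_mx (diag_mx (\row_i ('X - (d i)%:C%:P)))
    (\col_i - (a i)%:P) (\row_i - (a i)^*%:P) ('X - b%:C%:P)%:M.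
  rewrite /M /char_poly_mx /arrow_mx map_block_mx scalar_mx_block opp_block_mx.
  rewrite add_block_mx !sub0r; congr block_mx.
  - by apply/matrixP => i j; rewrite !mxE; case: eqP => _;
      rewrite ?mulr1n ?mulr0n ?polyC0 ?subr0.
  - by apply/matrixP => i j; rewrite !mxE.
  - by apply/matrixP => i j; rewrite !mxE.
  - by apply/matrixP => i j; rewrite !ord1 !mxE eqxx !mulr1n.
rewrite det_arrow => [|i]; last by rewrite polyXsubC_eq0.
rewrite /arrow_poly rmorphB rmorphM /= map_polyXsubC rmorph_prod rmorph_sum.
congr (_ * _ - _).
  by apply: eq_bigr => i _; rewrite /= map_polyXsubC.
apply: eq_bigr => i _; rewrite rmorphM rmorph_prod /= map_polyC /=.
congr (_ * _); last by apply: eq_bigr => j _; rewrite /= map_polyXsubC.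
by rewrite mulrNN -polyCM mulrC -sqr_normc; congr polyC; rewrite rmorphXn.
Qed.

(** * Eigenvalue bounds *)

Theorem lemma3p6 (R : realType) (n : nat) (hn : (2 <= n)%N)
    (d : 'I_n.-1 -> R) (a : 'I_n.-1 -> R[i]) (b : R)
    (lambda : 'I_(n.-1 + 1) -> R[i])
    (hlambda : eigenvalues_of (arrow_mx d a b) lambda)
    (eps : R) (heps : 0 < eps)
    (hb : (2 * n%:R - 3) / eps * (\sum_i ComplexField.Normc.normc (a i) ^+ 2)
          + (n%:R - 1) * (\sum_i `|d i|)
          + (n%:R - 2) * eps / (2 * n%:R - 3) <= b) :
  exists s : 'S_(n.-1 + 1),
    (forall alpha : 'I_n.-1,
        (d alpha - eps)%:C < lambda (s (lshift 1 alpha))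
        /\ lambda (s (lshift 1 alpha)) < (d alpha + eps)%:C)
    /\ b%:C <= lambda (s (rshift n.-1 ord0))
    /\ lambda (s (rshift n.-1 ord0)) < (b + (n%:R - 1) * eps)%:C.
Proof.
pose c i := ComplexField.Normc.normc (a i) ^+ 2.
have c0 i : 0 <= c i by rewrite sqr_ge0.
have n2 : 2 <= n%:R :> R by rewrite ler_nat.
(* As [2n - 3] and [n - 1] are at least 1 and the last term of [hb] is nonnegative, [b] is at least
   [(\sum_j c j) / eps] plus the sum of the [|d j|], which bounds [d i]. *)
have cb i : \sum_j c j <= eps * (b - d i).
  have S0 : 0 <= \sum_j c j by apply: sumr_ge0.
  have D0 : 0 <= \sum_j `|d j| by apply: sumr_ge0.
  have dD : d i <= \sum_j `|d j|.
    by rewrite (bigD1 i) //= (le_trans (ler_norm _)) // lerDl sumr_ge0.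
  have h1 : (\sum_j c j) / eps <= (2 * n%:R - 3) / eps * \sum_j c j.
    rewrite mulrAC ler_pM2r ?invr_gt0 // ler_peMl //; lra.
  have h2 : \sum_j `|d j| <= (n%:R - 1) * \sum_j `|d j| by rewrite ler_peMl //; lra.
  have h3 : 0 <= (n%:R - 2) * eps / (2 * n%:R - 3).
    by rewrite divr_ge0 ?mulr_ge0 ?(ltW heps) //; lra.
  rewrite -ler_pdivrMl // mulrC; move: hb; rewrite -/(\sum_j c j); lra.
pose s := sort (relpre d <=%R) (index_enum 'I_n.-1).
have ps : perm_eq s (index_enum 'I_n.-1) by rewrite perm_sort.
have us : uniq s by rewrite sort_uniq index_enum_uniq.
have ds : sorted (relpre d <=%R) s by apply: sort_sorted => i j; apply: le_total.
have [|i _|mu muP] := arrow_poly_split R _ d c b eps s heps us ds.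
- by move=> i _.
- by rewrite (perm_big _ ps).
have {}muP i : d i - eps < mu i <= d i.
  by apply: muP; rewrite (perm_mem ps) mem_index_enum.
set nu := b + \sum_(i <- s) _ => splitP.
have nuE : nu = b + \sum_i (d i - mu i).
  by rewrite [nu](congr1 (+%R b) (perm_big _ ps)) /=.
pose ev (k : 'I_(n.-1 + 1)) : R[i] :=
  match split k with inl i => (mu i)%:C | inr _ => nu%:C end.
have evE : \prod_k ('X - (lambda k)%:P) = \prod_k ('X - (ev k)%:P).
  rewrite -hlambda char_poly_arrow_mx -/c.
  have -> : arrow_poly d c b (index_enum 'I_n.-1) = arrow_poly d c b s.
    rewrite /arrow_poly !(perm_big _ ps) /=.
    congr (_ - _); apply: eq_bigr => i _; congr (_ * _).
    by rewrite (perm_big _ ps).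
  rewrite splitP (perm_big _ ps) /= rmorphM rmorph_prod /= map_polyXsubC.
  rewrite big_split_ord /= big_ord1 mulrC; congr (_ * _).
    by apply: eq_bigr => i _; rewrite /= map_polyXsubC /ev (unsplitK (inl i)).
  by rewrite /ev (unsplitK (inr ord0)).
(* Unique factorization; with [ev] on the left, the permutation acts on [lambda]. *)
have /prod_XsubC_eq/tuple_permP[p pE] :
    \prod_(x <- [tuple ev k | k < n.-1 + 1]) ('X - x%:P) =
    \prod_(x <- [tuple lambda k | k < n.-1 + 1]) ('X - x%:P).
  rewrite !big_tuple; symmetry; under eq_bigr do rewrite tnth_mktuple.
  by rewrite evE; apply: eq_bigr => k _; rewrite tnth_mktuple.
have {pE} pE k : lambda (p k) = ev k.
  have /val_inj tE := pE.
  by have := congr1 (fun t => tnth t k) tE; rewrite !tnth_mktuple.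
have lE i : lambda (p (lshift 1 i)) = (mu i)%:C.
  by rewrite pE /ev (unsplitK (inl i)).
have rE : lambda (p (rshift n.-1 ord0)) = nu%:C.
  by rewrite pE /ev (unsplitK (inr ord0)).
exists p; split=> [i|].
  by rewrite lE !ltcR; case/andP: (muP i) => mu1 mu2; split=> //; lra.
rewrite rE lecR ltcR nuE; split.
  by rewrite lerDl sumr_ge0 // => i _; rewrite subr_ge0; case/andP: (muP i).
have -> : (n%:R - 1) * eps = \sum_(i < n.-1) eps.
  by rewrite sumr_const card_ord -[RHS]mulr_natl -subn1 natrB // ltnW.
rewrite ltrD2l; apply: ltr_sum => [|i _].
  (* Strictness of the summed bound needs a nonempty index set, hence [n >= 2]. *)
  have n1 : (0 < n.-1)%N by rewrite -subn1 subn_gt0.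
  by apply/hasP; exists (Ordinal n1); rewrite ?mem_index_enum.
by case/andP: (muP i) => mu1 mu2; lra.
Qed.
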